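(* Let $(\Omega,\Sigma,\mathbb{P})$ be a nonatomic probability space. Let $\mathcal{K}$ be a convex bounded subset of $\mathbb{L}^1(\mathbb{P})$ that is closed in $\mathbb{L}^0(\mathbb{P})$ with respect to the $\mathbb{L}^0(\mathbb{P})$-topology. The following are equivalent. (1) There exists a probability measure $\mathbb{Q}\sim\mathbb{P}$ such that the $\mathbb{L}^0(\mathbb{Q})$- and $\mathbb{L}^1(\mathbb{Q})$-topologies agree on $\mathcal{K}$. (2) There exists a probability measure $\mathbb{Q}\sim\mathbb{P}$ such that $\mathcal{K}$ is $\mathbb{Q}$-uniformly integrable.
   Context: $\mathbb{L}^0(\mathbb{P})$ is the space of all real random variables on $(\Omega,\Sigma)$ modulo a.s. equality; the $\mathbb{L}^0(\mathbb{P})$-topology is the topology of convergence in probability. Bounded in $\mathbb{L}^1(\mathbb{P})$ means $\sup_{X\in\mathcal{K}}\mathbb{E}_{\mathbb{P}}[|X|]<\infty$. $\mathbb{Q}\sim\mathbb{P}$ means that $\mathbb{Q}$ is a probability measure on $(\Omega,\Sigma)$ mutually absolutely continuous with $\mathbb{P}$; then $\mathbb{L}^0(\mathbb{Q})=\mathbb{L}^0(\mathbb{P})$ with the same topology. That the $\mathbb{L}^0(\mathbb{Q})$- and $\mathbb{L}^1(\mathbb{Q})$-topologies agree on $\mathcal{K}$ means that $\mathcal{K}\subseteq\mathbb{L}^1(\mathbb{Q})$ and the relative topologies on $\mathcal{K}$ inherited from $\mathbb{L}^0(\mathbb{Q})$ (convergence in probability) and from the norm of $\mathbb{L}^1(\mathbb{Q})$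 coincide. *)

(* Defs.v *)
From HB Require Import structures.
From mathcomp Require Import all_boot all_order all_algebra.
From mathcomp Require Import all_classical all_reals all_analysis.
(* all_analysis alone does not provide the zmodType structure of {mfun T >-> R}. *)
From mathcomp Require Import measurable_realfun.

Set Implicit Arguments.
Unset Strict Implicit.
Unset Printing Implicit Defensive.
Import Order.TTheory GRing.Theory Num.Theory.
Import numFieldNormedType.Exports.
Local Open Scope classical_set_scope.
Local Open Scope ring_scope.
Local Open Scope quotient_scope.

Definition L0 d (T : measurableType d) (R : realType) (P : probability T R)
  : Type := {mfun_ P, T >-> R}.

Section L0_lmodType.
Context d (T : measurableType d) (R : realType) (P : probability T R).
Local Notation L0 := (L0 P).
Local Notation M := {mfun T >-> R}.

HB.instance Definition _ := Choice.copy L0 {mfun_ P, T >-> R}.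
HB.instance Definition _ := EqQuotient.copy L0 {mfun_ P, T >-> R}.

(* A representative of the class X; every use below is invariant under
   a.s. equality. *)
Definition L0_fun (X : L0) : M := repr X.
Coercion L0_fun : L0 >-> MeasurableFun.type.

Definition L0_class (f : M) : L0 := \pi_L0 f.

Lemma L0_classP (f g : M) : L0_class f = L0_class g <-> f = g %[ae P].
Proof.
split=> [/eqP|fg].
  by rewrite /L0_class eqmodE => /asboolP.
by apply/eqP; rewrite /L0_class eqmodE; apply/asboolP.
Qed.

Lemma L0_funK (X : L0) : L0_class X = X.
Proof. exact: reprK. Qed.

Lemma L0_classK (f : M) : (L0_class f : M) = f %[ae P].
Proof. by apply/L0_classP; rewrite L0_funK. Qed.

Definition L0_zero : L0 := L0_class 0.
Definition L0_opp (X : L0) : L0 := L0_class (- (X : M)).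
Definition L0_add (X Y : L0) : L0 := L0_class ((X : M) + (Y : M)).
Definition L0_scale (a : R) (X : L0) : L0 := L0_class (a *: (X : M)).

Lemma L0_addE (f g : M) : L0_add (L0_class f) (L0_class g) = L0_class (f + g).
Proof.
apply/L0_classP; have := L0_classK f; have := L0_classK g.
apply: filterS2 => x /= /(_ I) gx /(_ I) fx _.
by change (L0_class f x + L0_class g x = f x + g x); rewrite gx fx.
Qed.

Lemma L0_oppE (f : M) : L0_opp (L0_class f) = L0_class (- f).
Proof.
apply/L0_classP; have := L0_classK f.
apply: filterS => x /= /(_ I) fx _.
by change (- L0_class f x = - f x); rewrite fx.
Qed.

Lemma L0_scaleE a (f : M) : L0_scale a (L0_class f) = L0_class (a *: f).
Proof.
apply/L0_classP; have := L0_classK f.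
apply: filterS => x /= /(_ I) fx _.
by change (a * L0_class f x = a * f x); rewrite fx.
Qed.

Let L0_addA : associative L0_add.
Proof.
move=> X Y Z; rewrite -(L0_funK X) -(L0_funK Y) -(L0_funK Z).
by rewrite !L0_addE addrA.
Qed.

Let L0_addC : commutative L0_add.
Proof. by move=> X Y; rewrite /L0_add addrC. Qed.

Let L0_add0 : left_id L0_zero L0_add.
Proof. by move=> X; rewrite -(L0_funK X) L0_addE add0r. Qed.

Let L0_addN : left_inverse L0_zero L0_opp L0_add.
Proof. by move=> X; rewrite -(L0_funK X) L0_oppE L0_addE addNr. Qed.

HB.instance Definition _ :=
  GRing.isZmodule.Build L0 L0_addA L0_addC L0_add0 L0_addN.

Let L0_scaleA a b (X : L0) :
  L0_scale a (L0_scale b X) = L0_scale (a * b) X.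
Proof. by rewrite -(L0_funK X) !L0_scaleE scalerA. Qed.

Let L0_scale1 : left_id 1 L0_scale.
Proof. by move=> X; rewrite -(L0_funK X) L0_scaleE scale1r. Qed.

Let L0_scaleDr : right_distributive L0_scale +%R.
Proof.
move=> a X Y; rewrite -(L0_funK X) -(L0_funK Y) /GRing.add/=.
by rewrite !(L0_scaleE, L0_addE) scalerDr.
Qed.

Let L0_scaleDl (X : L0) : {morph L0_scale^~ X : a b / a + b}.
Proof.
move=> a b; rewrite -(L0_funK X) [RHS]/GRing.add/=.
by rewrite !(L0_scaleE, L0_addE) scalerDl.
Qed.

HB.instance Definition _ :=
  GRing.Zmodule_isLmodule.Build R L0
    L0_scaleA L0_scale1 L0_scaleDr L0_scaleDl.

End L0_lmodType.

Section L0_topology.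
Context d (T : measurableType d) (R : realType) (P : probability T R).
Local Notation L0 := (L0 P).

(* Balls of the Ky Fan metric, which metrizes convergence in probability
   (see L0_cvgP). *)
Definition L0_ball (X : L0) (e : R) : set L0 :=
  [set Y : L0 | (P [set w | e <= `|X w - Y w|]%R < e%:E)%E].

Let mE (X Y : L0) e : measurable [set w | e <= `|X w - Y w|].
Proof.
rewrite -[X in measurable X]setTI; apply: measurable_fun_le => //.
by apply: measurableT_comp => //; exact: measurable_funB.
Qed.

Let ball_center (X : L0) e : 0 < e -> L0_ball X e X.
Proof.
move=> e0; rewrite /L0_ball/= [X in P X](_ : _ = set0) ?measure0//.
by apply/seteqP; split=> w //=; rewrite subrr normr0 leNgt e0.
Qed.

Let ball_sym (X Y : L0) e : L0_ball X e Y -> L0_ball Y e X.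
Proof. by rewrite /L0_ball/=; under eq_set do rewrite distrC. Qed.

Let ball_triangle (X Y Z : L0) e1 e2 :
  L0_ball X e1 Y -> L0_ball Y e2 Z -> L0_ball X (e1 + e2) Z.
Proof.
rewrite /L0_ball/= => XY YZ; rewrite EFinD.
apply: le_lt_trans (lteD XY YZ).
apply: le_trans (measureU2 _ (mE X Y e1) (mE Y Z e2)).
apply: le_measure; rewrite ?inE//; first exact: measurableU.
move=> w /= h; have [?|l1] := leP e1 `|X w - Y w|; [by left|right].
rewrite leNgt; apply/negP => l2.
have := ltrD l1 l2; rewrite ltNge => /negP; apply.
by rewrite (le_trans h)// -[leLHS](_ : `|(X w - Y w) + (Y w - Z w)| = _)
  ?ler_normD// addrA subrK.
Qed.

HB.instance Definition _ := hasNbhs.Build L0 (nbhs_ (entourage_ L0_ball)).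
HB.instance Definition _ := Nbhs_isPseudoMetric.Build R L0
  erefl ball_center ball_sym ball_triangle erefl.

End L0_topology.

Definition L1 d (T : measurableType d) (R : realType) (P : probability T R)
  : Type := {X : L0 P | (X : T -> R) \in Lfun P 1}.

Section L1_topology.
Context d (T : measurableType d) (R : realType) (P : probability T R).
Local Notation L1 := (L1 P).

HB.instance Definition _ := Choice.copy L1 {X : L0 P | (X : T -> R) \in Lfun P 1}.

Definition L1_incl (X : L1) : L0 P := val X.
Coercion L1_incl : L1 >-> L0.

Definition L1_ball (X : L1) (e : R) : set L1 :=
  [set Y : L1 | ('N[P]_1[EFin \o (fun w => X w - Y w)%R] < e%:E)%E].

Let mB (X Y : L1) : measurable_fun [set: T] (fun w => X w - Y w).
Proof. exact: measurable_funB. Qed.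

Let ball_center (X : L1) e : 0 < e -> L1_ball X e X.
Proof.
move=> e0; rewrite /L1_ball/= (_ : _ \o _ = cst 0%E) ?Lnorm0//.
by apply/funext => w /=; rewrite subrr.
Qed.

Let ball_sym (X Y : L1) e : L1_ball X e Y -> L1_ball Y e X.
Proof.
rewrite /L1_ball/= -oppe_Lnorm; congr (Lnorm _ _ _ < _)%E.
by apply/funext => w /=; rewrite -[in RHS]opprB.
Qed.

Let ball_triangle (X Y Z : L1) e1 e2 :
  L1_ball X e1 Y -> L1_ball Y e2 Z -> L1_ball X (e1 + e2) Z.
Proof.
rewrite /L1_ball/= => XY YZ; rewrite EFinD.
apply: le_lt_trans (lteD XY YZ).
rewrite [X in (Lnorm _ _ (_ \o X) <= _)%E](_ : _ =
  (fun w => X w - Y w) \+ (fun w => Y w - Z w)); last first.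
  by apply/funext => w /=; rewrite addrA subrK.
by apply: eminkowski.
Qed.

HB.instance Definition _ := hasNbhs.Build L1 (nbhs_ (entourage_ L1_ball)).
HB.instance Definition _ := Nbhs_isPseudoMetric.Build R L1
  erefl ball_center ball_sym ball_triangle erefl.

End L1_topology.

Lemma L0_cvgP d (T : measurableType d) (R : realType) (P : probability T R)
    (X_ : nat -> L0 P) (X : L0 P) :
  (X_ n @[n --> \oo] --> X) <->
  (forall e : R, 0 < e ->
    (P [set w | e <= `|X w - X_ n w|]%R @[n --> \oo] --> 0)%E).
Proof.
have mE (Y Z : L0 P) e : measurable [set w | e <= `|Y w - Z w|].
  rewrite -[X in measurable X]setTI; apply: measurable_fun_le => //.
  by apply: measurableT_comp => //; exact: measurable_funB.
split=> [/cvg_ballP XX e e0|XX].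
  apply/fine_cvgP; split.
    by apply: nearW => n; rewrite fin_num_measure.
  apply/cvgrPdist_lt => r r0.
  pose m := Num.min e r.
  have m0 : 0 < m by rewrite lt_min e0.
  apply: filterS (XX _ m0) => n; rewrite /ball/= /L0_ball/= => h.
  rewrite sub0r normrN ger0_norm ?fine_ge0// -lte_fin fineK ?fin_num_measure//.
  apply: le_lt_trans (lt_le_trans h _); last by rewrite lee_fin ge_min lexx orbT.
  apply: le_measure; rewrite ?inE// => w /=; apply: le_trans.
  by rewrite ge_min lexx.
apply/cvg_ballP => e e0.
have /fine_cvgP[_ /cvgrPdist_lt /(_ _ e0)] := XX e e0.
apply: filterS => n; rewrite sub0r normrN ger0_norm ?fine_ge0// -lte_fin.
by rewrite fineK ?fin_num_measure.
Qed.

Lemma L1_cvgP d (T : measurableType d) (R : realType) (P : probability T R)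
    (X_ : nat -> L1 P) (X : L1 P) :
  (X_ n @[n --> \oo] --> X) <->
  ('N[P]_1[EFin \o (fun w => X w - X_ n w)%R] @[n --> \oo] --> 0)%E.
Proof.
have fn (Y Z : L1 P) : 'N[P]_1[EFin \o (fun w => Y w - Z w)%R]%E \is a fin_num.
  rewrite ge0_fin_numE ?Lnorm_ge0//.
  have [_ /(_ (-1) _ _ (valP Z) (valP Y))] :=
    Lfun_submod_closed P (lexx (1 : \bar R)%E).
  by rewrite scaleN1r addrC inE => /andP[_ /[!inE]].
split=> [/cvg_ballP XX|/fine_cvgP[_ XX]].
  apply/fine_cvgP; split; first exact: nearW.
  apply/cvgrPdist_lt => r r0; apply: filterS (XX _ r0) => n h.
  by rewrite sub0r normrN ger0_norm ?fine_ge0 ?Lnorm_ge0// -lte_fin fineK.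
apply/cvg_ballP => e e0; move/cvgrPdist_lt : XX => /(_ _ e0).
apply: filterS => n; rewrite sub0r normrN ger0_norm ?fine_ge0 ?Lnorm_ge0//.
by rewrite -lte_fin fineK.
Qed.

Section changes_of_probability.
Context d (T : measurableType d) (R : realType).

Definition equivalent (Q P : probability T R) := Q `<< P /\ P `<< Q.

(* For equivalent P and Q the null sets are the same, and this is the
   identification of the P-classes with the Q-classes. *)
Definition L0_change (P Q : probability T R) (X : L0 P) : L0 Q :=
  L0_class Q X.

Lemma L0_change_class (P Q : probability T R) (f : {mfun T >-> R}) :
  equivalent Q P -> L0_change Q (L0_class P f) = L0_class Q f.
Proof.
move=> [QP _]; apply/L0_classP.
by apply: (null_dominates_ae_eq measurableT QP); exact: L0_classK.
Qed.

Lemma L0_changeK (P Q : probability T R) :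
  equivalent Q P -> cancel (@L0_change P Q) (@L0_change Q P).
Proof.
move=> [QP PQ] X; apply: etrans (L0_funK X).
by apply: L0_change_class; split.
Qed.

End changes_of_probability.

Section subsets_of_L0.
Context d (T : measurableType d) (R : realType).

Definition nonatomic (P : probability T R) :=
  forall A, measurable A -> (0 < P A)%E ->
  exists B, [/\ measurable B, B `<=` A, (0 < P B)%E & (P B < P A)%E].

Definition L1_subset (P : probability T R) (K : set (L0 P)) :=
  K `<=` range (@L1_incl _ _ _ P).

Definition L1_bounded (P : probability T R) (K : set (L0 P)) :=
  (ereal_sup [set 'E_P[fun w => `|X w|%R] | X in K] < +oo)%E.

Definition L0_L1_topologies_agree (Q : probability T R) (K : set (L0 Q)) :=
  L1_subset K /\
  [set K `&` U | U in [set U : set (L0 Q) | open U]] =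
  [set K `&` (@L1_incl _ _ _ Q @` V) | V in [set V : set (L1 Q) | open V]].

(* The bound on the supremum over K is spelled out elementwise because
   ereal_sup set0 = -oo would exclude the empty family. *)
Definition uniformly_integrable (Q : probability T R) (K : set (L0 Q)) :=
  forall e : R, 0 < e -> \forall c \near +oo, forall X, K X ->
    (\int[Q]_(w in [set w | c < `|X w|]%R) `|X w|%:E <= e%:E)%E.

End subsets_of_L0.

(* Main.v *)
(* Both directions hold with the same Q.  That uniform integrability makes the
   topologies agree is Vitali's argument.

   Conversely, let the topologies agree on K under Q.  Since K is bounded in
   probability, t X + (1 - t) X0 is close to X0 in probability, hence in
   L1(Q), uniformly in X in K for t small: K is bounded in L1(Q).  Suppose K
   is not uniformly integrable.  Choosing X_n in K and events A_n with
   Q(A_n) -> 0 so that E[|X_n|; A_n] is nearly the largest possible value,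
   almost no mass of X_n lies on the other A_m, and there are functions g_k,
   bounded by 1 and supported on events of vanishing probability, such that
   E[g_k X_n] >= c > 0 for all n >= k.  The sets
   C_k = {X in K | E[g_j X] >= c for all j <= k} are convex, nonempty and
   decreasing.  Almost minimizers Y_k of the strictly convex functional
   X |-> E[sqrt(1 + X^2)] on C_k form a Cauchy sequence for convergence in
   probability; the limit Y belongs to K as K is closed, so Y_k -> Y in L1(Q),
   and E[g_k Y_m] is arbitrarily small for k, m large: a contradiction. *)
Require Import Defs.
From HB Require Import structures.
From mathcomp Require Import all_boot all_order all_algebra.
From mathcomp Require Import all_classical all_reals all_analysis.
From mathcomp Require Import measurable_realfun ring lra.
Set Implicit Arguments.
Unset Strict Implicit.
Unset Printing Implicit Defensive.
Import Order.TTheory GRing.Theory Num.Theory.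
Import numFieldNormedType.Exports.
Local Open Scope classical_set_scope.
Local Open Scope ring_scope.

(** * Strict convexity of sqrt(1 + x^2), made quantitative *)

Section strictly_convex.
Context {R : realType}.
Implicit Types x y M e : R.

Definition bracket x : R := Num.sqrt (1 + x ^+ 2).

Lemma bracket_ge1 x : 1 <= bracket x.
Proof.
by rewrite -[leLHS]sqrtr1 ler_sqrt ?lerDl ?sqr_ge0// addr_ge0 ?sqr_ge0.
Qed.

Lemma sqr_bracket x : bracket x ^+ 2 = 1 + x ^+ 2.
Proof. by rewrite sqr_sqrtr// addr_ge0// sqr_ge0. Qed.

Lemma bracket_le x : bracket x <= 1 + `|x|.
Proof.
rewrite -(@ler_pXn2r _ 2)// ?nnegrE ?addr_ge0// ?sqrtr_ge0// sqr_bracket.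
by have := normr_ge0 x; rewrite -[x ^+ 2]real_normK ?num_real//; nra.
Qed.

(** Cauchy-Schwarz for the vectors (1, x) and (1, y), whose Euclidean norms are [bracket x] and
    [bracket y]. *)
Lemma mul_bracket_ge x y : 1 + x * y <= bracket x * bracket y.
Proof.
have h : 0 <= bracket x * bracket y by rewrite mulr_ge0// sqrtr_ge0.
have [xy|xy] := leP (1 + x * y) 0; first exact: le_trans h.
rewrite -(@ler_pXn2r _ 2)// ?nnegrE ?(ltW xy)// exprMn !sqr_bracket.
by have := sqr_ge0 (x - y); nra.
Qed.

Definition bracket_gap x y : R :=
  (bracket x + bracket y) / 2 - bracket ((x + y) / 2).

(** A difference of squares: it turns the defect of midpoint convexity into the defect in
    Cauchy-Schwarz. *)
Lemma bracket_gapE x y :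
  bracket_gap x y * ((bracket x + bracket y) / 2 + bracket ((x + y) / 2)) =
  (bracket x * bracket y - (1 + x * y)) / 2.
Proof.
rewrite /bracket_gap -subr_sqr sqr_bracket !expr_div_n !sqrrD !sqr_bracket.
by field.
Qed.

Lemma bracket_gap_ge0 x y : 0 <= bracket_gap x y.
Proof.
have h : 0 < (bracket x + bracket y) / 2 + bracket ((x + y) / 2).
  have := bracket_ge1 x; have := bracket_ge1 y.
  by have := bracket_ge1 ((x + y) / 2); lra.
rewrite -(pmulr_lge0 _ h) bracket_gapE divr_ge0// subr_ge0.
exact: mul_bracket_ge.
Qed.

(** Lagrange's identity writes (x - y)^2 as (a b)^2 - (1 + x y)^2, with a and b the brackets. On
    [-M, M] the factor a b - (1 + x y) is at most 4 (1 + M) times the gap by [bracket_gapE], and the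
    other factor is at most 2 (1 + M)^2. *)
Lemma bracket_gap_ge M e x y : 0 <= M -> `|x| <= M -> `|y| <= M ->
  0 <= e -> e <= `|x - y| ->
  e ^+ 2 <= bracket_gap x y * (8 * (1 + M) ^+ 3).
Proof.
move=> M0 xM yM e0 exy.
have g0 := bracket_gap_ge0 x y; have := bracket_gapE x y.
have := g0; rewrite {1}/bracket_gap subr_ge0.
move: (bracket_gap x y) g0 => g g0; move: (bracket ((x + y) / 2)) => m mab gE.
have := mul_bracket_ge x y; have := bracket_ge1 y; have := bracket_ge1 x.
have := sqr_bracket y; have := sqr_bracket x.
have : bracket x <= 1 + M by rewrite (le_trans (bracket_le x)) ?lerD2l.
have : bracket y <= 1 + M by rewrite (le_trans (bracket_le y)) ?lerD2l.
move: (bracket x) (bracket y) gE mab => a b gE mab bM aM a2 b2 a1 b1 ab.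
have e2 : e ^+ 2 <= (x - y) ^+ 2.
  by rewrite -[leRHS]real_normK ?num_real// ler_pXn2r ?nnegrE.
have ab2 : (x - y) ^+ 2 = (a * b - (1 + x * y)) * (a * b + (1 + x * y)).
  by rewrite -subr_sqr exprMn a2 b2; ring.
have abM : a * b <= (1 + M) ^+ 2 by rewrite expr2; apply: ler_pM => //; lra.
apply: (le_trans e2); rewrite ab2.
have h1 : (a * b - (1 + x * y)) <= g * (4 * (1 + M)).
  have := ler_wpM2l g0 (_ : (a + b) / 2 + m <= 2 * (1 + M)).
  by rewrite gE; lra.
have h2 : a * b + (1 + x * y) <= 2 * (1 + M) ^+ 2 by lra.
have h3 : 0 <= a * b - (1 + x * y) by lra.
have h4 : 0 <= 2 * (1 + M) ^+ 2 by rewrite mulr_ge0// sqr_ge0.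
apply: (le_trans (ler_wpM2l h3 h2)).
apply: (le_trans (ler_wpM2r h4 h1)).
by rewrite le_eqVlt; apply/orP; left; apply/eqP; ring.
Qed.

Lemma measurable_bracket : measurable_fun [set: R] bracket.
Proof.
have ms : measurable_fun [set: R] (@Num.sqrt R).
  apply: continuous_measurable_fun; exact: sqrt_continuous.
apply: (measurableT_comp ms (g := fun x => 1 + x ^+ 2)).
by apply: measurable_funD => //; exact: measurable_funX.
Qed.

End strictly_convex.

(** * Convergence in probability of functions, near-minimizers and completeness *)

Section convergence_in_probability.
Context d (T : measurableType d) (R : realType) (P : probability T R).
Implicit Types (f g : T -> R) (e M : R).

Local Notation integrable1 f := (P.-integrable [set: T] (EFin \o f)).

(** The Ky Fan ball of [L0_ball], for functions in place of classes, so that pointwise constructions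
    need no choice of representatives. *)
Definition close_in_prob e f g :=
  (P [set w | (e <= `|f w - g w|)%R] < e%:E)%E.

Lemma integrable1_measurable f : integrable1 f -> measurable_fun [set: T] f.
Proof. by case/integrableP => /measurable_EFinP. Qed.

Lemma integrable1_normr f : integrable1 f -> integrable1 (fun w => `|f w|).
Proof. by move=> fi; exact: (integrable_abse fi). Qed.

Lemma integrable1_le f g : measurable_fun [set: T] f ->
  (forall w, `|f w| <= `|g w|) -> integrable1 g -> integrable1 f.
Proof.
move=> mf fg; apply: le_integrable => //; first exact/measurable_EFinP.
by move=> w _ /=; rewrite lee_fin.
Qed.

Lemma integrable1D f g : integrable1 f -> integrable1 g ->
  integrable1 (fun w => f w + g w).
Proof. by move=> fi gi; exact: (integrableD measurableT fi gi). Qed.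

Lemma integrable1B f g : integrable1 f -> integrable1 g ->
  integrable1 (fun w => f w - g w).
Proof. by move=> fi gi; exact: (integrableB measurableT fi gi). Qed.

Lemma integrable1Z k f : integrable1 f -> integrable1 (fun w => k * f w).
Proof. by move=> fi; exact: (integrableZl measurableT k fi). Qed.

Lemma integrable1_cst k : integrable1 (fun=> k).
Proof. exact: (finite_measure_integrable_cst P k). Qed.

Lemma Rintegral_prob_cst k : \int[P]_w k = k.
Proof.
rewrite Rintegral_cst// -[RHS]mulr1; congr (_ * _).
by have /= -> := probability_setT P.
Qed.

Lemma measurable_ge e f : measurable_fun [set: T] f ->
  measurable [set w | e <= f w].
Proof.
move=> mf; rewrite -[X in measurable X]setTI.
exact: (measurable_fun_le measurableT (measurable_cst e) mf).
Qed.

Lemma measurable_normr_ge e f : measurable_fun [set: T] f ->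
  measurable [set w | e <= `|f w|].
Proof. by move=> mf; apply: measurable_ge; exact: measurableT_comp. Qed.

(** Markov's inequality. *)
Lemma prob_ge_le f e : integrable1 f -> 0 < e -> (forall w, 0 <= f w) ->
  (P [set w | (e <= f w)%R] <= (\int[P]_w f w / e)%:E)%E.
Proof.
move=> fi e0 f0; have mf := integrable1_measurable fi.
have mA := measurable_ge e mf.
rewrite EFinM muleC lee_pdivlMl// -[leLHS]integral_cst//.
rewrite /Rintegral fineK; last exact: integrable_fin_num.
apply: (@le_trans _ _ (\int[P]_(w in [set w | (e <= f w)%R]) (f w)%:E)%E).
  apply: ge0_le_integral => //.
  - by move=> w _; rewrite lee_fin ltW.
  - by apply/measurable_EFinP; exact: measurable_funS mf.
apply: ge0_subset_integral => //; first exact/measurable_EFinP.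
by move=> w _; rewrite lee_fin.
Qed.

Lemma integrable1_bracket f : integrable1 f ->
  integrable1 (fun w => bracket (f w)).
Proof.
move=> fi; apply: (@integrable1_le _ (fun w => 1 + `|f w|)).
- exact: measurableT_comp measurable_bracket (integrable1_measurable fi).
- move=> w; rewrite [leRHS]ger0_norm ?addr_ge0// [leLHS]ger0_norm ?bracket_le//.
  exact: le_trans (bracket_ge1 _).
- by apply: integrable1D; [exact: integrable1_cst|exact: integrable1_normr].
Qed.

Lemma integrable1_bracket_gap f g : integrable1 f -> integrable1 g ->
  integrable1 (fun w => bracket_gap (f w) (g w)).
Proof.
move=> fi gi; apply: integrable1B; last first.
  apply: integrable1_bracket.
  under [X in integrable1 X]eq_fun do rewrite mulrC.
  by apply: integrable1Z; exact: integrable1D.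
under [X in integrable1 X]eq_fun do rewrite mulrC.
by apply: integrable1Z; apply: integrable1D; exact: integrable1_bracket.
Qed.

(** Where both functions are below M in absolute value, a distance of at least e forces a definite
    convexity gap by [bracket_gap_ge], and Markov's inequality bounds the probability of such a
    gap. *)
Lemma prob_dist_ge_le M e f g : 0 <= M -> 0 < e ->
  integrable1 f -> integrable1 g ->
  (P [set w | (e <= `|f w - g w|)%R] <=
   P [set w | (M <= `|f w|)%R] + P [set w | (M <= `|g w|)%R] +
   (\int[P]_w bracket_gap (f w) (g w) / (e ^+ 2 / (8 * (1 + M) ^+ 3)))%:E)%E.
Proof.
move=> M0 e0 fi gi.
have mf := integrable1_measurable fi; have mg := integrable1_measurable gi.
have gapi := integrable1_bracket_gap fi gi.
set c := e ^+ 2 / _; have cM : 0 < 8 * (1 + M) ^+ 3.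
  by rewrite mulr_gt0// exprn_gt0// ltr_wpDr.
have c0 : 0 < c by rewrite divr_gt0// exprn_gt0.
set A := [set w | M <= `|f w|]; set B := [set w | M <= `|g w|].
pose D := [set w | c <= bracket_gap (f w) (g w)].
have mA : measurable A by exact: measurable_normr_ge.
have mB : measurable B by exact: measurable_normr_ge.
have mD : measurable D by apply: measurable_ge; exact: integrable1_measurable.
apply: (@le_trans _ _ (P (A `|` B `|` D))).
  apply: le_measure; rewrite ?inE.
  - by apply: measurable_normr_ge; exact: measurable_funB.
  - by apply: measurableU => //; exact: measurableU.
  - move=> w /= efg; have [?|fM] := leP M `|f w|; first by left; left.
    have [?|gM] := leP M `|g w|; [by left; right|right].
    rewrite /D/= /c ler_pdivrMr//.
    by apply: bracket_gap_ge => //; exact: ltW.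
apply: (le_trans (measureU2 _ _ mD)); first exact: measurableU.
apply: leeD; first exact: measureU2.
by apply: prob_ge_le => // w; exact: bracket_gap_ge0.
Qed.

(** The infima of [J] over the sets C n increase and stay below 1 + B. The midpoint of two late
    near-minimizers lies in an earlier set with nearly the same infimum, so their mean convexity gap
    is small and [prob_dist_ge_le] applies. *)
Lemma nested_convex_cauchy_in_prob (C : nat -> set (T -> R)) B :
  (forall n f, C n f -> integrable1 f) ->
  (forall n f, C n f -> \int[P]_w `|f w| <= B) ->
  (forall n, C n !=set0) ->
  {homo C : m n / (m <= n)%N >-> n `<=` m} ->
  (forall n f g, C n f -> C n g -> C n (fun w => (f w + g w) / 2)) ->
  exists y : nat -> T -> R, (forall n, C n (y n)) /\
    forall e, 0 < e -> exists N, forall m n, (N <= m)%N -> (N <= n)%N ->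
      close_in_prob e (y m) (y n).
Proof.
move=> Ci CB C0 Cn Cc.
pose J f := \int[P]_w bracket (f w); pose I n := inf (J @` C n).
have J0 f : 0 <= J f.
  by apply: Rintegral_ge0 => w _; exact: le_trans (bracket_ge1 _).
have JB n f : C n f -> J f <= 1 + B.
  move=> Cf; have fi := Ci _ _ Cf; have ni := integrable1_normr fi.
  apply: (@le_trans _ _ (\int[P]_w (1 + `|f w|))).
    apply: le_Rintegral => //; first exact: integrable1_bracket.
      by apply: integrable1D => //; exact: integrable1_cst.
    by move=> w _; exact: bracket_le.
  rewrite RintegralD//; last exact: integrable1_cst.
  by rewrite Rintegral_prob_cst lerD2l; exact: CB Cf.
have lbJ n : has_lbound (J @` C n) by exists 0 => _ [f _ <-].
have infJ n : has_inf (J @` C n).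
  by split=> //; have [f Cf] := C0 n; exists (J f), f.
have IJ n f : C n f -> I n <= J f.
  by move=> Cf; apply: ge_inf => //; exists f.
have [f0 Cf0] := C0 0%N.
have B0 : 0 <= B.
  by apply: le_trans (CB _ _ Cf0); exact: Rintegral_ge0.
have supI : has_sup (range I).
  split; first by exists (I 0%N), 0%N.
  exists (1 + B) => _ [n _ <-]; have [f Cf] := C0 n.
  exact: le_trans (IJ _ _ Cf) (JB _ _ Cf).
have near_inf n : exists f, C n f /\ J f < I n + n.+1%:R^-1.
  have n0 : 0 < n.+1%:R^-1 :> R by [].
  have [_ [f Cf <-] h] := inf_adherent n0 (infJ n).
  by exists f.
have [y yP] := choice near_inf.
exists y; split=> [n|e e0]; first by case: (yP n).
have yi n : integrable1 (y n) by apply: Ci (yP n).1.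
(* With this M each of the two tails has probability at most e / 8. The gap term is at most 2 dl / c
   = e / 4, so the total is e / 2. *)
pose M := 8 * B / e + 1; pose c := e ^+ 2 / (8 * (1 + M) ^+ 3).
have M1 : 1 <= M by rewrite lerDr divr_ge0 ?mulr_ge0// ltW.
have c0 : 0 < c.
  by rewrite divr_gt0 ?exprn_gt0// mulr_gt0// exprn_gt0//; lra.
pose dl := e * c / 8; have dl0 : 0 < dl by rewrite divr_gt0// mulr_gt0.
have [_ [N1 _ <-] hN1] := sup_adherent dl0 supI.
have [N2 hN2] : exists N2, N2.+1%:R^-1 < dl.
  exists (Num.trunc dl^-1); rewrite invf_plt ?posrE//; exact: truncnS_gt.
exists (maxn N1 N2) => m n; rewrite !geq_max => /andP[N1m N2m] /andP[N1n N2n].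
have Jy k : (N2 <= k)%N -> J (y k) < sup (range I) + dl.
  move=> N2k; apply: (lt_le_trans (yP k).2); apply: lerD.
    by apply: ub_le_sup; [case: supI|exists k].
  apply: le_trans (ltW hN2); rewrite lef_pV2 ?posrE// ler_nat ltnS.
  exact: N2k.
(* Both values of [J] are below sup + dl, and the midpoint, being in C N1, has [J] above sup -
   dl. *)
have gap : \int[P]_w bracket_gap (y m w) (y n w) <= 2 * dl.
  have C1 k : (N1 <= k)%N -> C N1 (y k) by move=> /Cn; apply; case: (yP k).
  have := IJ _ _ (Cc _ _ _ (C1 _ N1m) (C1 _ N1n)).
  have -> : \int[P]_w bracket_gap (y m w) (y n w) =
    (J (y m) + J (y n)) / 2 - J (fun w => (y m w + y n w) / 2).
    have ?:= integrable1_bracket (yi m); have ? := integrable1_bracket (yi n).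
    rewrite RintegralB//=; last 2 first.
    - under [X in integrable1 X]eq_fun do rewrite mulrC.
      by apply: integrable1Z; exact: integrable1D.
    - apply: integrable1_bracket.
      under [X in integrable1 X]eq_fun do rewrite mulrC.
      by apply: integrable1Z; exact: integrable1D.
    by rewrite RintegralZr ?RintegralD//; exact: integrable1D.
  by have := Jy _ N2m; have := Jy _ N2n; lra.
have tail k : (P [set w | (M <= `|y k w|)%R] <= (e / 8)%:E)%E.
  apply: (le_trans (prob_ge_le (integrable1_normr (yi k)) _ _)) => //.
    exact: lt_le_trans M1.
  rewrite lee_fin ler_pdivrMr; last exact: lt_le_trans M1.
  apply: le_trans (CB _ _ (yP k).1) _.
  have -> : e / 8 * M = B + e / 8 by rewrite /M; field; rewrite gt_eqF.
  by rewrite lerDl divr_ge0// ltW.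
apply: (@le_lt_trans _ _ ((e / 8)%:E + (e / 8)%:E + (2 * dl / c)%:E)%E); last first.
  rewrite -!EFinD lte_fin /dl [X in _ + X < _](_ : _ = e / 4).
    by lra.
  by field; rewrite gt_eqF.
apply: (le_trans (prob_dist_ge_le (M := M) _ e0 (yi m) (yi n))).
  exact: le_trans M1.
apply: leeD; first exact: leeD.
by rewrite lee_fin ler_pM2r// invr_gt0.
Qed.

Lemma close_in_prob_trans e1 e2 f g h : measurable_fun [set: T] f ->
  measurable_fun [set: T] g -> measurable_fun [set: T] h ->
  close_in_prob e1 f g -> close_in_prob e2 g h ->
  close_in_prob (e1 + e2) f h.
Proof.
move=> mf mg mh fg gh; rewrite /close_in_prob EFinD.
have mB (a b : T -> R) e : measurable_fun [set: T] a ->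
    measurable_fun [set: T] b -> measurable [set w | e <= `|a w - b w|].
  by move=> ma mb; apply: measurable_normr_ge; exact: measurable_funB.
apply: le_lt_trans (lteD fg gh).
apply: le_trans (measureU2 _ (mB _ _ _ mf mg) (mB _ _ _ mg mh)).
apply: le_measure; rewrite ?inE//; [exact: mB|by apply: measurableU; exact: mB|].
move=> w /= efh; have [?|fg1] := leP e1 `|f w - g w|; [by left|right].
rewrite leNgt; apply/negP => gh1; move: efh; apply/negP; rewrite -ltNge.
apply: le_lt_trans (ltrD fg1 gh1).
by rewrite -[leLHS](_ : `|(f w - g w) + (g w - h w)| = _) ?ler_normD// addrA subrK.
Qed.

Lemma normr_telescope_le (u : nat -> R) j :
  (forall i, (j <= i)%N -> `|u i.+1 - u i| <= 2^-1 ^+ i) ->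
  forall i, (j <= i)%N -> `|u i - u j| <= 2 * 2^-1 ^+ j.
Proof.
(* The exact partial sum of the geometric series is the bound that goes through the induction. *)
move=> uj i ji; apply: (@le_trans _ _ (2 * 2^-1 ^+ j - 2 * 2^-1 ^+ i)); last first.
  by rewrite gerBl mulr_ge0// exprn_ge0// invr_ge0.
elim: i ji => [|i IH]; first by rewrite leqn0 => /eqP ->; rewrite !subrr normr0.
rewrite leq_eqVlt => /predU1P[<-|]; first by rewrite !subrr normr0.
rewrite ltnS => ji.
rewrite -[u i.+1 - u j](_ : (u i.+1 - u i) + (u i - u j) = _); last by ring.
apply: le_trans (ler_normD _ _) _.
have := IH ji; have := uj i ji; rewrite exprS; lra.
Qed.

(** Completeness for convergence in probability: a fast subsequence converges almost surely by
    Borel-Cantelli, and the whole sequence stays close to it. *)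
Lemma cauchy_in_prob_cvg (y : nat -> T -> R) :
  (forall n, measurable_fun [set: T] (y n)) ->
  (forall e, 0 < e -> exists N, forall m n, (N <= m)%N -> (N <= n)%N ->
    close_in_prob e (y m) (y n)) ->
  exists f, measurable_fun [set: T] f /\
    forall e, 0 < e -> exists N, forall n, (N <= n)%N -> close_in_prob e f (y n).
Proof.
move=> my yC.
have r0 j : 0 < 2^-1 ^+ j :> R by rewrite exprn_gt0.
have [N NP] := choice (fun j => yC _ (r0 j)).
(* Cumulative sums make [u] monotone and above N; the successor in each summand gives j <= u j. *)
pose u j := (\sum_(i < j.+1) (N i).+1)%N.
have uS j : (u j <= u j.+1)%N by rewrite /u [leqRHS]big_ord_recr/= leq_addr.
have Nu j : (N j <= u j)%N.
  by rewrite (leq_trans (leqnSn _))// /u big_ord_recr/= leq_addl.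
have ju j : (j <= u j)%N.
  rewrite (@leq_trans (\sum_(i < j.+1) 1)%N) ?leq_sum//.
  by rewrite sum1_card card_ord.
have small e : 0 < e -> exists N3, forall j, (N3 <= j)%N -> 2 * 2^-1 ^+ j < e.
  move=> e0; have half1 : `|2^-1 : R| < 1 by rewrite ger0_norm; lra.
  have := @cvg_geometric R 2 _ half1 => /cvgrPdist_lt/(_ _ e0)[N3 _ N3P].
  exists N3 => j /N3P; rewrite sub0r normrN ger0_norm// mulr_ge0//.
pose z j := y (u j).
pose D j := [set w | 2^-1 ^+ j <= `|z j.+1 w - z j w|].
have mD j : measurable (D j).
  by apply: measurable_normr_ge; apply: measurable_funB; exact: my.
have PD j : (P (D j) <= (2^-1 ^+ j)%:E)%E.
  by apply: ltW; apply: NP; rewrite // (leq_trans (Nu j)).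
have PD_fin : (\sum_(n <oo) P (D n) < +oo)%E.
  have := @epsilon_trick0 R 2 xpredT => /(_ (ler0n _ _))/le_lt_trans.
  move=> /(_ +oo%E (ltry _)); apply: le_lt_trans.
  apply: lee_nneseries => //= n _; apply: le_trans (PD n) _.
  by rewrite lee_fin natrX exprS invfM mulrA divff// mul1r exprVn.
have D0 := lim_sup_set_cvg0 mD PD_fin.
have tail e : 0 < e -> exists N, forall j, (N <= j)%N ->
    (P (\bigcup_(k >= j) D k) < e%:E)%E.
  move=> e0; have := lim_sup_set_cvg P D mD; rewrite D0 => /(_ _)/fine_cvgP [].
    by rewrite (le_lt_trans (probability_le1 _ _)) ?ltry//; exact: bigcup_measurable.
  move=> _ /cvgrPdist_lt/(_ _ e0)[N' _ N'P]; exists N' => j /N'P.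
  rewrite sub0r normrN ger0_norm ?fine_ge0// -lte_fin fineK// fin_num_measure//.
  exact: bigcup_measurable.
pose G := ~` lim_sup_set D.
have mlimsup : measurable (lim_sup_set D).
  by apply: bigcap_measurable => // k _; exact: bigcup_measurable.
have mG : measurable G by exact: measurableC.
have zE j w : ~ (\bigcup_(k >= j) D k) w ->
    forall i, (j <= i)%N -> `|z i w - z j w| <= 2 * 2^-1 ^+ j.
  move=> nD; apply: (normr_telescope_le (u := fun i => z i w)) => i ji.
  by rewrite leNgt; apply/negP => /ltW h; apply: nD; exists i.
have zcvg w : G w -> cvgn (fun j => z j w).
  rewrite /G/lim_sup_set/= => /existsNP[j /not_implyP[_ nD]].
  apply/cauchy_cvgP/cauchy_exP => e e0.
  have [N3 N3P] := small e e0.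
  exists (z (maxn j N3) w); exists (maxn j N3) => //= i mi.
  rewrite /ball/= distrC.
  apply: le_lt_trans (N3P (maxn j N3) _); last by rewrite leq_maxr.
  apply: zE => //.
  move=> [k /= jk Dk]; apply: nD; exists k => //=.
  by rewrite (leq_trans _ jk)// leq_maxl.
(* Outside G the restricted sequence is constantly 0, so it converges at every point and its limit
   is measurable. *)
pose f w := limn (fun j => (z j \_ G) w).
have zGE w : G w -> (fun j => (z j \_ G) w) = (fun j => z j w).
  by move=> Gw; apply/funext => j; rewrite patchE mem_set.
have zf w : (fun j => (z j \_ G) w) @ \oo --> f w.
  have [Gw|nGw] := pselect (G w); first by rewrite /f zGE//; exact: zcvg.
  rewrite /f (_ : (fun j => _) = cst 0); first exact: is_cvg_cst.
  by apply/funext => j; rewrite patchE memNset.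
have mf : measurable_fun [set: T] f.
  apply: (measurable_fun_cvg (h := fun j => z j \_ G)) => [j|w _]; last exact: zf.
  by apply/(measurable_restrictT _ mG); exact: measurable_funS (my _).
exists f; split => // e e0.
have [N1 N1P] := tail (e / 2) ltac:(by rewrite divr_gt0).
have [N2 N2P] := yC (e / 2) ltac:(by rewrite divr_gt0).
have [N3 N3P] := small (e / 2) ltac:(by rewrite divr_gt0).
exists N2 => n N2n; rewrite [e]splitr.
(* N1 makes the union of the D k with k >= j improbable, N3 makes the telescoped distance off that
   union less than e / 2, and N2 <= j <= u j brings z j close to y n. *)
pose j := maxn (maxn N1 N2) N3.
have [N1j N2j N3j] : [/\ N1 <= j, N2 <= j & N3 <= j]%N.
  by rewrite /j !leq_max !leqnn !orbT.
apply: (@close_in_prob_trans _ _ _ (z j)) => //; first exact: my.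
  2: by apply: N2P => //; exact: leq_trans (ju j).
apply: le_lt_trans (N1P j N1j).
apply: le_measure; rewrite ?inE//.
- apply: measurable_normr_ge; apply: measurable_funB => //; exact: my.
- exact: bigcup_measurable.
- move=> w /= ew; apply: contrapT => nD; move: ew; apply/negP; rewrite -ltNge.
  apply: le_lt_trans (N3P j N3j).
  have Gw : G w by move=> /(_ j I).
  have fE : (fun i => z i w) @ \oo --> f w.
    by have := zf w; rewrite zGE.
  have dE : (fun i => `|z i w - z j w|) @ \oo --> `|f w - z j w|.
    by apply: cvg_norm; apply: cvgB => //; exact: cvg_cst.
  rewrite -(cvg_lim _ dE)//; apply: limr_le.
    by apply/cvg_ex; exists `|f w - z j w|.
  by exists j => // i /= ji; exact: zE.
Qed.

End convergence_in_probability.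

(** * Sign functions on small events that detect concentrated mass *)

Section bumps.
Context d (T : measurableType d) (R : realType) (P : probability T R).
Implicit Types (f g : T -> R) (e s : R).

Local Notation integrable1 f := (P.-integrable [set: T] (EFin \o f)).

(** [Rintegral] sends an infinite integral to 0, so this is meaningful for families of integrable
    functions, the only ones it is used for. *)
Definition uniformly_abs_continuous (F : set (T -> R)) :=
  forall e, 0 < e -> exists2 s, 0 < s & forall f A, F f -> measurable A ->
    (P A <= s%:E)%E -> \int[P]_(w in A) `|f w| <= e.

Lemma integrable1_restrict f A : measurable A -> integrable1 f ->
  integrable1 (f \_ A).
Proof.
move=> mA fi; rewrite -restrict_EFin.
by apply/(integrable_mkcond _ mA); exact: integrableS fi.
Qed.

Variables (x : nat -> T -> R) (A : nat -> set T).
Hypothesis mx : forall n, measurable_fun [set: T] (x n).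
Hypothesis mA : forall n, measurable (A n).

Definition hull k n := \bigcup_(l in [set l | (k <= l < n)%N]) A l.

Lemma measurable_hull k n : measurable (hull k n).
Proof. exact: bigcup_measurable. Qed.

Lemma hullS k n : (k <= n)%N -> hull k n.+1 = A n `|` (hull k n `\` A n).
Proof.
move=> kn; apply/seteqP; split=> w.
  move=> [l /= /andP[kl]]; rewrite ltnS leq_eqVlt => /predU1P[->|ln Alw].
    by left.
  have [?|?] := pselect (A n w); [by left|right; split => //].
  by exists l => //=; rewrite kl.
move=> [Anw|[[l /= /andP[kl ln] Alw] _]]; first by exists n => //=; rewrite kn leqnn.
by exists l => //=; rewrite kl/= ltnS ltnW.
Qed.

Lemma hullSl k n : hull k n `<=` A k `|` hull k.+1 n.
Proof.
move=> w [l /= /andP[kl ln] Alw].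
move: kl; rewrite leq_eqVlt => /predU1P[kl|kl]; first by left; rewrite kl.
by right; exists l => //=; rewrite kl.
Qed.

(* At a point w the function sign_last k n takes the sign of x l w for the
   last l in [k, n[ such that w is in A l; for n large it stands for g_k. *)
Fixpoint sign_last k n : T -> R := if n is m.+1 then
    fun w => if (k <= m)%N && (w \in A m) then Num.sg (x m w) else sign_last k m w
  else cst 0.

Lemma measurable_sign_last k n : measurable_fun [set: T] (sign_last k n).
Proof.
elim: n => [|n IH] //=; apply: measurable_fun_ifT => //.
  apply: measurable_and => //; apply: (measurable_fun_bool true).
  rewrite setTI (_ : _ @^-1` _ = A n)//.
  by apply/seteqP; split=> w /=; [exact: set_mem|exact: mem_set].
rewrite (_ : (fun w => _) =
    fun w => if 0 < x n w then 1 else if x n w < 0 then -1 else 0).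
  by do 2![apply: measurable_fun_ifT => //; first exact: measurable_fun_ltr].
by apply/funext => w; case: sgrP.
Qed.

Lemma normr_sign_last_le1 k n w : `|sign_last k n w| <= 1.
Proof.
elim: n => [|n IH] /=; first by rewrite normr0.
by case: ifP => // _; rewrite normr_sg lern1 leq_b1.
Qed.

Lemma sign_last_eq0 k n w : ~ hull k n w -> sign_last k n w = 0.
Proof.
elim: n => [|n IH] //= nw; case: ifPn => [/andP[kn /set_mem Anw]|_].
  by exfalso; apply: nw; exists n => //=; rewrite kn leqnn.
apply: IH => -[l /= /andP[kl ln] Alw]; apply: nw.
by exists l => //=; rewrite kl/= ltnS ltnW.
Qed.

Lemma sign_lastE k n i w : (k <= i < n)%N -> A i w -> ~ hull i.+1 n w ->
  sign_last k n w = Num.sg (x i w).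
Proof.
move=> /andP[ki]; elim: n => // n IH.
rewrite ltnS leq_eqVlt => /predU1P[<-|ltin] Aiw nw /=; first by rewrite ki mem_set.
case: ifPn => [/andP[kn /set_mem Anw]|_].
  by exfalso; apply: nw; exists n => //=; rewrite ltin leqnn.
apply: IH => // -[l /= /andP[kl ln] Alw]; apply: nw.
by exists l => //=; rewrite kl/= ltnS ltnW.
Qed.

Lemma integrable1_sign_lastM k n f : integrable1 f ->
  integrable1 (fun w => sign_last k n w * f w).
Proof.
move=> fi; apply: (@integrable1_le _ _ _ _ _ f) => //.
  apply: measurable_funM; first exact: measurable_sign_last.
  exact: integrable1_measurable fi.
by move=> w; rewrite normrM ler_piMl// normr_sign_last_le1.
Qed.

(** On A i away from later events the product is |x i|. On the later events and on the earlier ones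
    it is at least -|x i|; the factor 2 also cancels the gain credited at points of A i lying in a
    later event. *)
Lemma sign_lastM_ge k i n w : (k <= i < n)%N ->
  ((fun w => `|x i w|) \_ (A i)) w
    - 2 * ((fun w => `|x i w|) \_ (hull i.+1 n)) w
    - ((fun w => `|x i w|) \_ (hull k i `\` A i)) w
  <= sign_last k n w * x i w.
Proof.
move=> kin; have x0 := normr_ge0 (x i w).
have lb : - `|x i w| <= sign_last k n w * x i w.
  rewrite lerNl; apply: le_trans (ler_norm _) _.
  by rewrite normrN normrM ler_piMl// normr_sign_last_le1.
rewrite !patchE (_ : point = 0)//.
case: (boolP (w \in hull i.+1 n)) => [|/negP] wH.
  by case: ifP => _; case: ifP => _; lra.
have {}wH : ~ hull i.+1 n w by move=> /mem_set.
case: (boolP (w \in A i)) => [/set_mem wA|/negP wA].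
  rewrite (sign_lastE kin wA wH) mulrC -normrEsg memNset; first by lra.
  by case.
case: ifPn => [_|/negP wB]; first by lra.
rewrite sign_last_eq0; first by lra.
move=> [l /= /andP[kl ln] Alw]; apply: wB; apply/mem_set.
have [il|li|il] := ltngtP i l.
- by exfalso; apply: wH; exists l => //=; rewrite il.
- by split; [exists l => //=; rewrite kl|move=> /mem_set].
- by exfalso; apply: wA; apply/mem_set; rewrite il.
Qed.

Variables (s : nat -> R) (eta eps : R).
Hypothesis xi : forall n, integrable1 (x n).
Hypothesis PA : forall n, (P (A n) <= (s n / 2)%:E)%E.
Hypothesis s_gt0 : forall n, 0 < s n.
Hypothesis s_half : forall n, s n.+1 <= s n / 2.
Hypothesis xA : forall n, eta - eps <= \int[P]_(w in A n) `|x n w|.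
Hypothesis x_small : forall n B, measurable B -> (P B <= (s n.+1)%:E)%E ->
  \int[P]_(w in B) `|x n w| <= eps.
Hypothesis x_max : forall n B, measurable B -> (P B <= (s 0)%:E)%E ->
  \int[P]_(w in B) `|x n w| <= eta + eps.

(** A k takes at most s k / 2 and the later events at most s k.+1 <= s k / 2, by induction on n - k.
    The bound is independent of n. *)
Lemma prob_hull k n : (P (hull k n) <= (s k)%:E)%E.
Proof.
have [m] := ubnP (n - k)%N; elim: m k => // m IH k.
rewrite ltnS => nkm; have [nk|kn] := leqP n k.
  rewrite (_ : hull k n = set0) ?measure0 ?lee_fin ?ltW//.
  apply/seteqP; split => // w [l /= /andP[kl ln] _].
  by have := leq_ltn_trans (leq_trans nk kl) ln; rewrite ltnn.
apply: (@le_trans _ _ (P (A k `|` hull k.+1 n))).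
  apply: le_measure; rewrite ?inE//; last exact: hullSl.
    exact: measurable_hull.
  by apply: measurableU => //; exact: measurable_hull.
apply: le_trans (measureU2 _ _ _) _ => //; first exact: measurable_hull.
rewrite [s k]splitr EFinD; apply: leeD; first exact: PA.
apply: le_trans (IH _ _) _; last by rewrite lee_fin.
by rewrite subnS prednK ?subn_gt0// (leq_trans _ nkm)// ltn_predL subn_gt0.
Qed.

Lemma s_le0 k : s k <= s 0.
Proof.
elim: k => // k IH; apply: le_trans (s_half k) _; have := s_gt0 k; lra.
Qed.

(** The mass of x i is at least eta - eps on A i and at most eps on the later events, whose union
    has probability at most s i.+1. On the earlier events outside A i it is at most 2 eps, since
    with A i they carry at most eta + eps. The total loss is 1 + 2 + 2 times eps. *)
Lemma Rintegral_sign_lastM_ge k i n : (k <= i < n)%N ->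
  eta - 5 * eps <= \int[P]_w (sign_last k n w * x i w).
Proof.
move=> kin; have [ki ltin] := andP kin; have nxi := integrable1_normr (xi i).
pose a := fun w => `|x i w|.
have mH := measurable_hull; have mD := measurableD (mH k i) (mA i).
apply: (@le_trans _ _ (\int[P]_w
    ((a \_ (A i)) w - 2 * (a \_ (hull i.+1 n)) w - (a \_ (hull k i `\` A i)) w))).
  have i1 := integrable1_restrict (mA i) nxi.
  have i2 := integrable1_restrict (mH i.+1 n) nxi.
  have i3 := integrable1_restrict mD nxi.
  have i4 := integrable1Z 2 i2.
  rewrite RintegralB//; last exact: integrable1B.
  rewrite RintegralB// RintegralZl// -!Rintegral_mkcond.
  have := xA i; have := x_small (mH i.+1 n) (prob_hull _ _).
  have := x_max i (mH k i.+1) _; rewrite (hullS ki) Rintegral_setU//; last 2 first.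
  - by apply: integrableS nxi => //; exact: measurableU.
  - by rewrite disj_set2E; apply/eqP; rewrite setDE setICA setICr setI0.
  rewrite -(hullS ki) => /(_ (le_trans (prob_hull k i.+1) _)).
  by rewrite lee_fin s_le0 => /(_ isT); rewrite /a; lra.
apply: le_Rintegral => //.
- by do 2?apply: integrable1B; rewrite ?integrable1Z//; exact: integrable1_restrict.
- exact: integrable1_sign_lastM.
- by move=> w _; exact: sign_lastM_ge.
Qed.

End bumps.

(** * Uniform absolute continuity of convex closed families *)

Section uniform_absolute_continuity.
Context d (T : measurableType d) (R : realType) (P : probability T R).
Implicit Types (f g : T -> R) (e s : R).

Local Notation integrable1 f := (P.-integrable [set: T] (EFin \o f)).

Lemma le_Rintegral_setT f A : measurable A -> integrable1 f ->
  \int[P]_(w in A) `|f w| <= \int[P]_w `|f w|.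
Proof.
move=> mA /integrable1_normr fi; rewrite [leLHS]Rintegral_mkcond.
have fAi := integrable1_restrict mA fi.
apply: le_Rintegral => // w _; rewrite patchE; case: ifP => _ //.
exact: normr_ge0.
Qed.

Lemma integral_abs_continuous f e : integrable1 f -> 0 < e ->
  exists2 s, 0 < s & forall A, measurable A -> (P A <= s%:E)%E ->
    \int[P]_(w in A) `|f w| < e.
Proof.
move=> fi e0; have [r [r0 rP]] := integral_normr_continuous fi e0.
(* Halving passes from the strict bound P A < r to a non-strict one. *)
exists (r / 2); first by rewrite divr_gt0.
move=> A mA PA; apply: rP => //; apply: le_lt_trans PA _.
by rewrite lte_fin; lra.
Qed.

Variables (F : set (T -> R)) (B : R).
Hypothesis Fi : forall f, F f -> integrable1 f.
Hypothesis FB : forall f, F f -> \int[P]_w `|f w| <= B.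

(* The sequence is built so that the mass each x n carries on small sets is,
   up to eps, the largest one possible; hence almost all of it sits on A n. *)
Lemma not_uniformly_abs_continuous : ~ uniformly_abs_continuous P F ->
  exists (x : nat -> T -> R) (A : nat -> set T) (s : nat -> R) (c : R),
  [/\ 0 < c,
    forall n, F (x n), forall n, measurable (A n),
    (forall k n, P (hull A k n) <= (s k)%:E)%E /\
      (forall e, 0 < e -> exists k, s k <= e) &
    forall k i n, (k <= i < n)%N ->
      c <= \int[P]_w (sign_last x A k n w * x i w)].
Proof.
move=> nF.
(* S holds the amounts of mass that members of F carry on events of arbitrarily small probability;
   its supremum [eta] measures the failure of uniform absolute continuity. *)
pose S := [set r | forall s, 0 < s -> exists p : (T -> R) * set T,
  [/\ F p.1, measurable p.2, (P p.2 <= s%:E)%E &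
      r <= \int[P]_(w in p.2) `|p.1 w|]].
have [e0 [e0_gt0 Se0]] : exists e0, 0 < e0 /\ S e0.
  apply: contrapT => h; apply: nF => e e0; apply: contrapT => nP; apply: h.
  exists e; split => // s s0; apply: contrapT => nE; apply: nP.
  exists s => // f A Ff mA PA; rewrite leNgt; apply/negP => /ltW lt.
  by apply: nE; exists (f, A).
have supS : has_sup S.
  split; first by exists e0.
  exists B => r /(_ 1 ltr01)[[f A] /= [Ff mA _ rA]].
  by apply: le_trans rA (le_trans (le_Rintegral_setT mA (Fi Ff)) (FB Ff)).
(* With this eps the final bound eta - 5 eps equals eta / 2. *)
pose eta := sup S; pose eps := eta / 10.
have eta0 : 0 < eta.
  by apply: lt_le_trans e0_gt0 _; apply: ub_le_sup => //; case: supS.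
have eps0 : 0 < eps by rewrite divr_gt0.
have near_eta s : 0 < s -> exists p : (T -> R) * set T,
    [/\ F p.1, measurable p.2, (P p.2 <= s%:E)%E &
        eta - eps <= \int[P]_(w in p.2) `|p.1 w|].
  move=> s0; have [r Sr rlt] := sup_adherent eps0 supS.
  have [p [Fp mp Pp rp]] := Sr _ s0; exists p; split => //.
  exact: le_trans (ltW rlt) rp.
(* Since eta + eps exceeds the supremum of S, it is not attained below some scale s0. *)
have [s0 s0_gt0 s0P] : exists2 s0, 0 < s0 & forall f A, F f -> measurable A ->
    (P A <= s0%:E)%E -> \int[P]_(w in A) `|f w| <= eta + eps.
  apply: contrapT => nP.
  have : S (eta + eps).
    move=> s s_gt0; apply: contrapT => nE; apply: nP; exists s => //.
    move=> f A Ff mA PA; rewrite leNgt; apply/negP => /ltW lt.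
    by apply: nE; exists (f, A).
  move=> /(ub_le_sup supS.2); rewrite -/eta; lra.
(* At scale s, choose a function and an event nearly attaining eta, then a next scale at which this
   function is negligible. Positivity of s is placed under the existential so that the choice is a
   total function; for s <= 0 the triple is a dummy. *)
have step s : exists p : (T -> R) * set T * R, 0 < s ->
    [/\ F p.1.1, measurable p.1.2,
      (P p.1.2 <= (s / 2)%:E)%E /\ eta - eps <= \int[P]_(w in p.1.2) `|p.1.1 w|,
      0 < p.2 <= s / 2 &
      forall B, measurable B -> (P B <= p.2%:E)%E ->
        \int[P]_(w in B) `|p.1.1 w| <= eps].
  have [s_gt0|_] := ltP 0 s; last by exists (cst 0, set0, 0).
  have [[f A] /= [Ff mA PA fA]] := near_eta (s / 2) ltac:(by rewrite divr_gt0).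
  have [t t0 tP] := integral_abs_continuous (Fi Ff) eps0.
  exists (f, A, Num.min (s / 2) t) => _; split => //=.
    by rewrite lt_min t0 divr_gt0//= ge_min lexx.
  move=> D mD PD; apply: ltW; apply: tP => //; apply: le_trans PD _.
  by rewrite lee_fin ge_min lexx orbT.
have [st stP] := choice step.
pose s := fix s n := if n is m.+1 then (st (s m)).2 else s0.
have s_gt0 n : 0 < s n.
  by elim: n => // n IH /=; have [_ _ _ /andP[]] := stP _ IH.
pose x n := (st (s n)).1.1; pose A n := (st (s n)).1.2.
have Fx n : F (x n) by have [] := stP _ (s_gt0 n).
have mA n : measurable (A n) by have [] := stP _ (s_gt0 n).
have PA n : (P (A n) <= (s n / 2)%:E)%E by have [_ _ []] := stP _ (s_gt0 n).
have s_half n : s n.+1 <= s n / 2.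
  by have [_ _ _ /andP[_]] := stP _ (s_gt0 n).
exists x, A, s, (eta / 2); split => //.
- by rewrite divr_gt0.
- split; first by move=> k n; exact: prob_hull.
  move=> e e_gt0.
  have sn n : s n <= s0 * 2^-1 ^+ n.
    elim: n => [|n IH]; first by rewrite mulr1.
    by apply: le_trans (s_half n) _; rewrite exprSr mulrA ler_pM2r// invr_gt0.
  have half1 : `|2^-1 : R| < 1 by rewrite ger0_norm; lra.
  have := @cvg_geometric R s0 _ half1 => /cvgrPdist_lt/(_ _ e_gt0)[N _ NP].
  exists N; apply: le_trans (sn N) _; have /= := NP N (leqnn N).
  by rewrite sub0r normrN => /ltW; apply: le_trans; exact: ler_norm.
- move=> k i n kin.
  rewrite [leLHS](_ : _ = eta - 5 * eps); last by rewrite /eps; field.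
  apply: (@Rintegral_sign_lastM_ge _ _ _ _ _ _ _ mA s) => //.
  + by move=> m; apply: integrable1_measurable; exact: Fi.
  + by move=> m; exact: Fi.
  + by move=> m; have [_ _ []] := stP _ (s_gt0 m).
  + by move=> m; have [_ _ _ _] := stP _ (s_gt0 m).
  + by move=> m D mD PD; exact: s0P.
Qed.

Hypothesis F_mid : forall f g, F f -> F g -> F (fun w => (f w + g w) / 2).
Hypothesis F_closed : forall (y : nat -> T -> R) f, measurable_fun [set: T] f ->
  (forall n, F (y n)) ->
  (forall e, 0 < e -> exists N, forall n, (N <= n)%N -> close_in_prob P e f (y n)) ->
  F f.
Hypothesis F_agree : forall f e, F f -> 0 < e ->
  exists2 r, 0 < r & forall g, F g -> close_in_prob P r f g ->
    \int[P]_w `|f w - g w| < e.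

Lemma convex_closed_uniformly_abs_continuous : uniformly_abs_continuous P F.
Proof.
apply: contrapT => /not_uniformly_abs_continuous[x [A [s [c]]]].
move=> [c0 Fx mA [Phull s0] xc].
have mx n : measurable_fun [set: T] (x n) by exact: integrable1_measurable (Fi _).
have gMi k n f : F f -> integrable1 (fun w => sign_last x A k n w * f w).
  by move=> /Fi; exact: integrable1_sign_lastM.
(* The condition on the bump g_j is imposed on its finite stages [sign_last x A j n] for all large
   n, so no limit in n has to be formed. *)
pose C m := [set f | F f /\ forall j, (j <= m)%N -> exists N, forall n, (N <= n)%N ->
  c <= \int[P]_w (sign_last x A j n w * f w)].
have [|||||y [Cy ycauchy]] := @nested_convex_cauchy_in_prob _ _ _ P C B.
- by move=> n f [/Fi].
- by move=> n f [/FB].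
(* The stage must exceed n strictly for the event A n to be taken into account. *)
- move=> n; exists (x n); split => // j jn; exists n.+1 => m nm.
  by apply: xc; rewrite jn.
- move=> m n mn f [Ff fP]; split => // j jm; apply: fP.
  exact: leq_trans mn.
- move=> n f g [Ff fP] [Fg gP]; split; first exact: F_mid.
  move=> j jn; have [N1 N1P] := fP _ jn; have [N2 N2P] := gP _ jn.
  exists (maxn N1 N2) => m; rewrite geq_max => /andP[N1m N2m].
  rewrite (_ : (fun w => _) = fun w =>
    (sign_last x A j m w * f w + sign_last x A j m w * g w) * 2^-1); last first.
    by apply/funext => w; rewrite -mulrDr mulrA.
  rewrite RintegralZr//; last by apply: integrable1D; exact: gMi.
  rewrite RintegralD//; [|exact: gMi..].
  by have := N1P _ N1m; have := N2P _ N2m; lra.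
have Fy n : F (y n) by case: (Cy n).
have [n|f [mf yf]] := cauchy_in_prob_cvg _ ycauchy.
  exact: integrable1_measurable (Fi _).
have Ff : F f by exact: F_closed yf.
have c20 : 0 < c / 2 by rewrite divr_gt0.
have [t t0 tP] := integral_abs_continuous (Fi Ff) c20.
have [r r0 rP] := F_agree Ff c20.
have [k skt] := s0 _ t0; have [N NP] := yf _ r0.
(* m >= k puts the constraint on bump k among those satisfied by y m; m >= N makes y m close to f in
   mean. *)
pose m := maxn k N.
have dm : \int[P]_w `|f w - y m w| < c / 2.
  by apply: rP => //; apply: NP; exact: leq_maxr.
have [_ /(_ k (leq_maxl _ _))[n /(_ n (leqnn n))]] := Cy m.
apply/negP; rewrite -ltNge.
have mH := measurable_hull mA k n.
(* The bump is bounded by 1 and vanishes off the hull, so its product with y m is at most |f - y m|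
   plus |f| on the hull; each term integrates to less than c / 2. *)
apply: (@le_lt_trans _ _
    (\int[P]_w (`|f w - y m w| + ((fun w => `|f w|) \_ (hull A k n)) w))).
  have i1 := integrable1_normr (integrable1B (Fi Ff) (Fi (Fy m))).
  have i2 := integrable1_restrict mH (integrable1_normr (Fi Ff)).
  apply: le_Rintegral => //; [exact: gMi|exact: integrable1D|move=> w _].
  rewrite patchE; case: ifPn => [_|/negP wH].
    apply: le_trans (ler_norm _) _.
    rewrite normrM (le_trans (ler_piMl _ (normr_sign_last_le1 _ _ _ _ _)))//.
    rewrite distrC -[leLHS](_ : `|(y m w - f w) + f w| = _) ?ler_normD//.
    by rewrite subrK.
  by rewrite sign_last_eq0 ?mul0r ?addr0// => /mem_set.
rewrite RintegralD//; last 2 first.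
- exact: integrable1_normr (integrable1B (Fi Ff) (Fi (Fy m))).
- exact: integrable1_restrict mH (integrable1_normr (Fi Ff)).
rewrite -Rintegral_mkcond.
have := tP _ mH (le_trans (Phull k n) _); rewrite lee_fin => /(_ skt); lra.
Qed.

End uniform_absolute_continuity.

(** * Invariance under almost sure equality *)

Section almost_everywhere.
Context d (T : measurableType d) (R : realType) (P : probability T R).
Implicit Types (f g : T -> R) (e : R).

Local Notation integrable1 f := (P.-integrable [set: T] (EFin \o f)).

Lemma prob_ae_eq (A B : set T) : measurable A -> measurable B ->
  (\forall w \ae P, A w <-> B w) -> P A = P B.
Proof.
suff le (C D : set T) : measurable C -> measurable D ->
    (\forall w \ae P, C w <-> D w) -> (P C <= P D)%E.
  move=> mA mB AB; apply/eqP; rewrite eq_le !le//.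
  by apply: filterS AB => w; exact: iff_sym.
move=> mC mD [N [mN N0 CDN]].
apply: (@le_trans _ _ (P (D `|` N))).
  apply: le_measure; rewrite ?inE//; first exact: measurableU.
  move=> w Cw; have [CD|nCD] := pselect (C w <-> D w); first by left; apply/CD.
  by right; exact: CDN.
by apply: le_trans (measureU2 _ mD mN) _; rewrite -[leRHS]adde0 -N0.
Qed.

Lemma close_in_prob_ae e f f' g g' :
  measurable_fun [set: T] f -> measurable_fun [set: T] f' ->
  measurable_fun [set: T] g -> measurable_fun [set: T] g' ->
  f = f' %[ae P] -> g = g' %[ae P] ->
  close_in_prob P e f g -> close_in_prob P e f' g'.
Proof.
move=> mf mf' mg mg' ff' gg'; rewrite /close_in_prob.
rewrite (@prob_ae_eq _ [set w | e <= `|f' w - g' w|])//.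
- by apply: measurable_normr_ge; exact: measurable_funB.
- by apply: measurable_normr_ge; exact: measurable_funB.
- by apply: filterS2 ff' gg' => w /= /(_ I) -> /(_ I) ->.
Qed.

Lemma eq_ae_sym f g : f = g %[ae P] -> g = f %[ae P].
Proof. by apply: filterS => w h wT; rewrite h. Qed.

Lemma eq_ae_trans f g h : f = g %[ae P] -> g = h %[ae P] -> f = h %[ae P].
Proof. by apply: filterS2 => w fg gh wT; rewrite fg// gh. Qed.

Lemma Rintegral_ae_eq f g : measurable_fun [set: T] f ->
  measurable_fun [set: T] g -> f = g %[ae P] -> \int[P]_w f w = \int[P]_w g w.
Proof.
move=> mf mg fg; congr fine; apply: ae_eq_integral => //.
- exact/measurable_EFinP.
- exact/measurable_EFinP.
- by apply: filterS fg => w /= h wT; rewrite h.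
Qed.

Lemma integrable1_ae_eq f g : measurable_fun [set: T] g -> f = g %[ae P] ->
  integrable1 f -> integrable1 g.
Proof.
move=> mg fg fi; have mf := integrable1_measurable fi.
case/integrableP : fi => _ fi; apply/integrableP; split.
  exact/measurable_EFinP.
apply: le_lt_trans fi; rewrite le_eqVlt; apply/orP; left; apply/eqP.
apply: ge0_ae_eq_integral => //.
- by do 2?apply: measurableT_comp => //; exact/measurable_EFinP.
- by do 2?apply: measurableT_comp => //; exact/measurable_EFinP.
- by apply: filterS fg => w /= h wT; rewrite h.
Qed.

End almost_everywhere.

(** * Absolute continuity in epsilon-delta form *)

Section domination.
Context d (T : measurableType d) (R : realType) (P Q : probability T R).

(** The Radon-Nikodym density of Q is P-integrable, so its integral is small on events of small
    P-probability. *)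
Lemma dominates_abs_continuous e : Q `<< P -> 0 < e -> exists2 s : R, 0 < s &
  forall A, measurable A -> (P A <= s%:E)%E -> (Q A < e%:E)%E.
Proof.
move=> QP e0.
have [f [f0 ffin fi fE]] := radon_nikodym_sigma_finite QP.
have fgi : P.-integrable [set: T] (EFin \o (fine \o f)).
  by rewrite (_ : _ \o _ = f)//; apply/funext => w /=; rewrite fineK.
have [s s0 sP] := integral_abs_continuous fgi e0.
exists s => // A mA /(sP _ mA); rewrite -lte_fin; apply: le_lt_trans.
rewrite fE// /Rintegral fineK; last first.
  apply: integrable_fin_num => //; apply: integrableS (integrable1_normr fgi) => //.
rewrite le_eqVlt; apply/orP; left; apply/eqP; apply: eq_integral => w _.
by rewrite ger0_norm ?fine_ge0//= fineK.
Qed.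

End domination.

(** * Agreement of the two topologies as a continuity condition *)

Section topologies.
Context d (T : measurableType d) (R : realType) (Q : probability T R).
Implicit Types (K : set (L0 Q)).

Local Notation integrable1 f := (Q.-integrable [set: T] (EFin \o f)).

Lemma L1_integrable (V : L1 Q) : integrable1 (L1_incl V : T -> R).
Proof. by apply/Lfun1_integrable; exact: (valP V). Qed.

Lemma L1_subset_integrable K X : L1_subset K -> K X -> integrable1 (X : T -> R).
Proof. by move=> KL /KL[V _ <-]; exact: L1_integrable. Qed.

Lemma L1_ballE (V W : L1 Q) e :
  L1_ball V e W <-> \int[Q]_w `|(V : L0 Q) w - (W : L0 Q) w| < e.
Proof.
rewrite /L1_ball/= Lnorm1 -lte_fin /Rintegral fineK//.
apply: integrable_fin_num => //; apply: integrable1_normr.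
by apply: integrable1B; exact: L1_integrable.
Qed.

(** By Markov's inequality the inclusion of L1 into L0 is continuous, so agreement on K amounts to
    continuity, at each point of K, of the identity from the distance in probability to the distance
    in mean. *)
Lemma topologies_agreeP K : L0_L1_topologies_agree K <->
  L1_subset K /\ forall X (e : R), K X -> 0 < e -> exists2 r : R, 0 < r &
    forall Y, K Y -> close_in_prob Q r X Y -> \int[Q]_w `|X w - Y w| < e.
Proof.
split=> [[KL KE]|[KL KP]]; split => //.
- move=> X e KX e0; have [V _ VX] := KL _ KX.
  have : [set K `&` (@L1_incl _ _ _ Q @` V) | V in [set V : set (L1 Q) | open V]]
      (K `&` (@L1_incl _ _ _ Q @` (ball V e)°)).
    by exists (ball V e)° => //; exact: open_interior.
  rewrite -KE => -[U oU UE].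
  have : U X.
    have : (K `&` U) X.
      rewrite UE; split => //; exists V => //.
      by apply: nbhs_singleton; apply: nbhs_interior; exact: nbhsx_ballx.
    by case.
  move=> UX; have /nbhs_ballP[r /= r0 rU] := open_nbhs_nbhs (conj oU UX).
  exists r => // Y KY XY.
  have : (K `&` U) Y by split => //; exact: rU.
  rewrite UE => -[_ [W /interior_subset VW WY]].
  by move/L1_ballE : VW; rewrite VX WY.
- apply/seteqP; split => _ [U oU <-].
  + exists (@L1_incl _ _ _ Q @^-1` U); last first.
      apply/seteqP; split => X [KX].
        by move=> [V UV VX]; split => //; rewrite -VX.
      move=> UX; split => //; have [V _ VX] := KL _ KX.
      by exists V => //; rewrite /preimage/= VX.
    rewrite /= openE => V UV; apply/nbhs_ballP.
    have /nbhs_ballP[r /= r0 rU] := open_nbhs_nbhs (conj oU UV).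
    (* Markov's inequality at level r turns a mean distance below r^2 into a probability below r. *)
    exists (r * r); first by rewrite /= mulr_gt0.
    move=> W /L1_ballE VW; apply: rU; rewrite /ball/= /L0_ball/=.
    apply: le_lt_trans (prob_ge_le _ r0 _) _ => //.
      by apply: integrable1_normr; apply: integrable1B; exact: L1_integrable.
    by rewrite lte_fin ltr_pdivrMr.
  + exists ([set Y | K Y -> (@L1_incl _ _ _ Q @` U) Y]°); first exact: open_interior.
    apply/seteqP; split => X [KX].
      by move=> /interior_subset/(_ KX).
    move=> [V UV VX]; split => //.
    have /nbhs_ballP[e /= e0 eU] := open_nbhs_nbhs (conj oU UV).
    have [r r0 rP] := KP _ _ KX e0.
    apply/nbhs_ballP; exists r => // Y XY KY; have [W _ WY] := KL _ KY.
    exists W => //; apply: eU; apply/L1_ballE; rewrite VX WY.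
    exact: rP.
Qed.

End topologies.

(** * Uniform integrability and Vitali's argument *)

Section uniform_integrability.
Context d (T : measurableType d) (R : realType) (Q : probability T R).
Implicit Types (K : set (L0 Q)) (f : T -> R).

Local Notation integrable1 f := (Q.-integrable [set: T] (EFin \o f)).

Lemma measurable_L0 (X : L0 Q) : measurable_fun [set: T] X.
Proof. exact: measurable_funPT. Qed.
Hint Resolve measurable_L0 : core.

Lemma measurable_normr_gt c f : measurable_fun [set: T] f ->
  measurable [set w | c < `|f w|].
Proof.
move=> mf; rewrite (_ : [set w | _] = ~` [set w | `|f w| <= c]).
  apply: measurableC; rewrite -[X in measurable X]setTI.
  by apply: measurable_fun_le => //; exact: measurableT_comp.
by apply/seteqP; split => w /=; rewrite ltNge => /negP.
Qed.

Lemma uniformly_integrable_ex K e : uniformly_integrable K -> 0 < e ->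
  exists2 c : R, 0 < c & forall X, K X ->
    (\int[Q]_(w in [set w | (c < `|X w|)%R]) `|X w|%:E <= e%:E)%E.
Proof.
move=> Ku /Ku[M [_ MP]]; exists (`|M| + 1); first by rewrite ltr_wpDl.
by apply: MP; rewrite (le_lt_trans (ler_norm M))// ltrDl.
Qed.

Lemma normr_le_tail c f w :
  0 <= c -> `|f w| <= c + ((fun w => `|f w|) \_ [set w | c < `|f w|]) w.
Proof.
move=> c0; rewrite patchE (_ : point = 0)//; case: ifPn => [_|].
  by rewrite lerDr.
by rewrite notin_setE /= => /negP; rewrite -leNgt addr0.
Qed.

(** |X| is at most a constant plus its tail, and a single threshold already makes the tail
    integrable. *)
Lemma uniformly_integrable_L1_subset K : uniformly_integrable K -> L1_subset K.
Proof.
move=> /uniformly_integrable_ex/(_ ltr01)[c c0 cP] X KX.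
have := cP X KX; set A := [set w | _] => XA.
have mA : measurable A by exact: measurable_normr_gt.
suff Xi : integrable1 (X : T -> R).
  have XL : (X : T -> R) \in Lfun Q 1 by exact/Lfun1_integrable.
  by exists (exist _ X XL : L1 Q).
apply: (@integrable1_le _ _ _ _ _ (fun w => c + ((fun w => `|X w|) \_ A) w)) => //.
  by move=> w; apply: le_trans (ler_norm _); apply: normr_le_tail; exact: ltW.
apply: integrable1D; first exact: integrable1_cst.
rewrite -restrict_EFin; apply/(integrable_mkcond _ mA)/integrableP; split.
  by apply/measurable_EFinP; apply: measurable_funTS; exact: measurableT_comp.
by under eq_integral do rewrite /= normr_id; exact: le_lt_trans XA (ltry _).
Qed.

(** By Markov's inequality the event |X| > c has probability at most B / c, which is below s once c
    >= B / s. *)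
Lemma uniformly_abs_continuous_integrable K (F : set (T -> R)) B :
  (forall X, K X -> F X) -> (forall f, F f -> integrable1 f) ->
  (forall f, F f -> \int[Q]_w `|f w| <= B) ->
  uniformly_abs_continuous Q F -> uniformly_integrable K.
Proof.
move=> KF Fi FB Fu e e0; have [s s0 sP] := Fu _ e0.
near=> c => X KX; have FX := KF _ KX; have Xi := Fi _ FX.
have c0 : 0 < c by near: c; exact: nbhs_pinfty_gt.
have mA : measurable [set w | c < `|X w|] by exact: measurable_normr_gt.
rewrite -[leLHS]fineK; last first.
  apply: integrable_fin_num => //.
  by apply: integrableS (integrable1_normr Xi).
rewrite lee_fin; apply: sP => //.
apply: (@le_trans _ _ (Q [set w | c <= `|X w|])).
  apply: le_measure; rewrite ?inE//; first exact: measurable_normr_ge.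
  by move=> w /= /ltW.
apply: le_trans (prob_ge_le (integrable1_normr Xi) c0 _) _ => //.
rewrite lee_fin ler_pdivrMr//; apply: le_trans (FB _ FX) _.
rewrite -ler_pdivrMl// mulrC; near: c; exact: nbhs_pinfty_ge.
Unshelve. all: by end_near. Qed.

(** |X - Y| is at most r off the event D where it is at least r, and at most 2 c plus the two tails
    on D; uniform integrability bounds the tails for all Y in K at once. *)
Lemma uniformly_integrable_topologies_agree K :
  uniformly_integrable K -> L0_L1_topologies_agree K.
Proof.
move=> Ku; have KL := uniformly_integrable_L1_subset Ku.
apply/topologies_agreeP; split=> // X e KX e0.
have e80 : 0 < e / 8 by rewrite divr_gt0.
have [c c0 cP] := uniformly_integrable_ex Ku e80.
have {}cP Y : K Y -> \int[Q]_(w in [set w | c < `|Y w|]) `|Y w| <= e / 8.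
  move=> KY; rewrite -lee_fin /Rintegral fineK; first exact: cP.
  apply: integrable_fin_num; first exact: measurable_normr_gt.
  apply: integrableS (integrable1_normr (L1_subset_integrable KL KY)) => //.
  exact: measurable_normr_gt.
(* Chosen so that r + 2 c r = e / 4; the two tails add at most e / 4 more. *)
pose r := e / (4 * (1 + 2 * c)).
have r0 : 0 < r by rewrite divr_gt0// mulr_gt0//; lra.
exists r => // Y KY XY.
have Xi := L1_subset_integrable KL KX; have Yi := L1_subset_integrable KL KY.
pose D := [set w | r <= `|X w - Y w|].
have mD : measurable D by apply: measurable_normr_ge; exact: measurable_funB.
have mA (Z : L0 Q) : measurable [set w | c < `|Z w|] by exact: measurable_normr_gt.
pose tail (Z : L0 Q) : T -> R := (fun w => `|Z w|) \_ [set w | c < `|Z w|].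
have taili (Z : L0 Q) : integrable1 (Z : T -> R) -> integrable1 (tail Z).
  by move=> Zi; apply: integrable1_restrict => //; exact: integrable1_normr.
have Di : integrable1 (cst (2 * c) \_ D).
  by apply: integrable1_restrict => //; exact: integrable1_cst.
apply: (@le_lt_trans _ _
    (\int[Q]_w (r + (cst (2 * c) \_ D) w + tail X w + tail Y w))).
  have ri := integrable1_cst Q r.
  have i1 := integrable1D ri Di; have i2 := integrable1D i1 (taili _ Xi).
  apply: le_Rintegral => //.
  - by apply: integrable1_normr; exact: integrable1B.
  - by apply: integrable1D => //; exact: taili.
  move=> w _; rewrite -/(tail X) -/(tail Y).
  have tail0 (Z : L0 Q) : 0 <= tail Z w by rewrite /tail patchE; case: ifP.
  have := ler_normB (X w) (Y w); have := tail0 X; have := tail0 Y.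
  have := normr_le_tail X w (ltW c0); have := normr_le_tail Y w (ltW c0).
  rewrite -/(tail X) -/(tail Y) [(cst _ \_ D) w]patchE (_ : point = 0)//.
  case: ifPn => [_ /=|]; first by lra.
  by rewrite notin_setE /D/= => /negP; rewrite -ltNge; lra.
have ri := integrable1_cst Q r.
have i1 := integrable1D ri Di; have i2 := integrable1D i1 (taili _ Xi).
rewrite !RintegralD//; [|exact: taili..].
rewrite Rintegral_prob_cst -!Rintegral_mkcond.
rewrite Rintegral_cst//.
have := cP _ KX; have := cP _ KY.
have QD : fine (Q D) <= r.
  by rewrite -lee_fin fineK ?fin_num_measure// ltW.
have : 2 * c * fine (Q D) <= 2 * c * r by rewrite ler_wpM2l// mulr_ge0// ltW.
have : r + 2 * c * r = e / 4 by rewrite /r; field; rewrite gt_eqF//; lra.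
lra.
Qed.

End uniform_integrability.

(** * Boundedness in mean from tightness *)

Section convex_bounded.
Context d (T : measurableType d) (R : realType) (P : probability T R).
Variable F : set (T -> R).

Local Notation integrable1 f := (P.-integrable [set: T] (EFin \o f)).

Hypothesis Fi : forall f, F f -> integrable1 f.
Hypothesis F_convex : forall (t : R) f g, 0 <= t <= 1 -> F f -> F g ->
  F (fun w => t * f w + (1 - t) * g w).
Hypothesis F_tight : forall e : R, 0 < e -> exists2 M : R, 0 < M & forall f, F f ->
  (P [set w | (M <= `|f w|)%R] < e%:E)%E.
Hypothesis F_agree : forall f (e : R), F f -> 0 < e ->
  exists2 r : R, 0 < r & forall g, F g -> close_in_prob P r f g ->
    \int[P]_w `|f w - g w| < e.

(* For t small, t f + (1 - t) f0 is close to f0 in probability uniformly in f,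
   hence close to f0 in mean. *)
Lemma convex_tight_L1_bounded : exists B, forall f, F f -> \int[P]_w `|f w| <= B.
Proof.
have [[f0 Ff0]|nF] := pselect (exists f, F f); last first.
  by exists 0 => f Ff; exfalso; apply: nF; exists f.
have [r r0 rP] := F_agree Ff0 ltr01.
have r20 : 0 < r / 2 by rewrite divr_gt0.
have [M M0 MP] := F_tight r20.
(* Where |f0| and |f| are below M, t |f0 - f| < 2 t M <= r; each exceptional event has probability
   below r / 2. *)
pose t := Num.min 1 (r / (2 * M)).
have t0 : 0 < t by rewrite lt_min ltr01 divr_gt0// mulr_gt0.
have t1 : t <= 1 by rewrite ge_min lexx.
have tM : t * (2 * M) <= r by rewrite -ler_pdivlMr ?mulr_gt0// ge_min lexx orbT.
(* The mean distance from f0 to g is t times that from f0 to f, and it is below 1. *)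
exists (t^-1 + \int[P]_w `|f0 w|) => f Ff.
pose g w := t * f w + (1 - t) * f0 w.
have Fg : F g by apply: F_convex => //; rewrite ltW.
have f0i := Fi Ff0; have fi := Fi Ff; have gi := Fi Fg.
have mf0 := integrable1_measurable f0i; have mf := integrable1_measurable fi.
have mg := integrable1_measurable gi.
have gE w : `|f0 w - g w| = t * `|f0 w - f w|.
  by rewrite -[in RHS](gtr0_norm t0) -normrM; congr `|_|; rewrite /g; ring.
have f0g : close_in_prob P r f0 g.
  rewrite /close_in_prob [r in X in (_ < X)%E]splitr EFinD.
  apply: le_lt_trans (lteD (MP _ Ff0) (MP _ Ff)).
  have mM (h : T -> R) : measurable_fun [set: T] h ->
      measurable [set w | M <= `|h w|].
    exact: measurable_normr_ge.
  apply: le_trans (measureU2 _ (mM _ mf0) (mM _ mf)).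
  apply: le_measure; rewrite ?inE//.
  - by apply: measurable_normr_ge; exact: measurable_funB.
  - by apply: measurableU; exact: mM.
  - move=> w /=; rewrite gE => rt.
    have [?|f0M] := leP M `|f0 w|; [by left|right].
    rewrite leNgt; apply/negP => fM; move: rt; apply/negP; rewrite -ltNge.
    apply: lt_le_trans tM; rewrite ltr_pM2l//.
    by apply: le_lt_trans (ler_normB _ _) _; lra.
have := rP _ Fg f0g; under eq_Rintegral do rewrite gE.
have f0fi := integrable1_normr (integrable1B f0i fi).
rewrite RintegralZl// mulrC -ltr_pdivlMr// div1r => h.
apply: (@le_trans _ _ (\int[P]_w (`|f0 w - f w| + `|f0 w|))).
  apply: le_Rintegral => //; first exact: integrable1_normr.
    by apply: integrable1D => //; exact: integrable1_normr.
  by move=> w _; rewrite addrC -{1}(subKr (f0 w) (f w)) ler_normB.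
rewrite RintegralD ?lerD2r ?ltW//; exact: integrable1_normr.
Qed.

End convex_bounded.

(** * Transfer between P and Q and between classes and functions *)

Section change_of_probability.
#[local] Hint Resolve measurable_L0 : core.
Context d (T : measurableType d) (R : realType) (P Q : probability T R).
Variable K : set (L0 P).
Hypothesis QP : equivalent Q P.
Hypothesis K_convex : convex_set (K : set (convex_lmodType (L0 P))).
Hypothesis K_L1 : L1_subset K.
Hypothesis K_bounded : L1_bounded K.
Hypothesis K_closed : closed K.

Local Notation KQ := (L0_change Q @` K).

(** All measurable versions of members of K are kept, so that the set is stable under pointwise
    convex combinations and limits. *)
Definition representatives : set (T -> R) :=
  [set f | measurable_fun [set: T] f /\ exists2 X, K X & f = (X : T -> R) %[ae Q]].

Lemma representatives_L0_change (X : L0 Q) : KQ X -> representatives X.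
Proof.
by move=> [X0 KX0 <-]; split => //; exists X0 => //; exact: L0_classK.
Qed.

Lemma representativesP f : representatives f <->
  measurable_fun [set: T] f /\ exists2 X : L0 Q, KQ X & f = (X : T -> R) %[ae Q].
Proof.
split=> -[mf [X KX fX]]; split => //.
  exists (L0_change Q X); first by exists X.
  by apply: eq_ae_trans fX _; apply: eq_ae_sym; exact: L0_classK.
case: KX fX => X0 KX0 <- fX; exists X0 => //.
by apply: eq_ae_trans fX _; exact: L0_classK.
Qed.

Lemma representatives_convex (t : R) f g : 0 <= t <= 1 ->
  representatives f -> representatives g ->
  representatives (fun w => t * f w + (1 - t) * g w).
Proof.
move=> /andP[t0 t1] [mf [X KX fX]] [mg [Y KY gY]]; split.
  by apply: measurable_funD; exact: measurable_funM.
have := K_convex (Itv01 t0 t1) (mem_set KX) (mem_set KY).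
rewrite inE /conv/= => KZ.
exists (t *: X + (1 - t) *: Y); first exact: KZ.
rewrite (_ : t *: X + (1 - t) *: Y =
  L0_class P (t *: (X : {mfun T >-> R}) + (1 - t) *: (Y : {mfun T >-> R})));
  last exact: L0_addE.
apply: eq_ae_trans; last first.
  apply: (null_dominates_ae_eq measurableT QP.1).
  by apply: eq_ae_sym; exact: L0_classK.
by apply: filterS2 fX gY => w /= fX gY wT; rewrite fX// gY.
Qed.

(** K is closed for convergence in P-probability; as P is dominated by Q, convergence in
    Q-probability implies it. *)
Lemma representatives_closed (y : nat -> T -> R) f :
  measurable_fun [set: T] f -> (forall n, representatives (y n)) ->
  (forall e, 0 < e -> exists N, forall n, (N <= n)%N -> close_in_prob Q e f (y n)) ->
  representatives f.
Proof.
move=> mf yK yf; have f_mfun : f \in mfun by apply/mem_set.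
pose X := L0_class P (mfun_Sub f_mfun).
have fX : f = (X : T -> R) %[ae P].
  by apply: eq_ae_sym; exact: (L0_classK P (mfun_Sub f_mfun)).
split => //; exists X; last first.
  exact: (null_dominates_ae_eq measurableT QP.1).
apply: K_closed => U /nbhs_ballP[e /= e0 eU].
have [s s0 sP] := dominates_abs_continuous QP.2 e0.
(* The bound e concerns the distance, the bound s the Q-probability that makes the P-probability
   less than e. *)
have m0 : 0 < Num.min e s by rewrite lt_min e0.
have [N NP] := yf _ m0; have [my [Y KY yY]] := yK N.
exists Y; split => //; apply: eU; rewrite /ball/= /L0_ball/=.
have fY : close_in_prob Q (Num.min e s) f Y.
  apply: (close_in_prob_ae mf mf my _ _ yY (NP N (leqnn N))) => //; exact: aeW.
apply: (@close_in_prob_ae _ _ _ _ _ f _ Y) => //; last first.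
  apply: sP; first by apply: measurable_normr_ge; exact: measurable_funB.
  apply: le_trans (le_trans (ltW fY) _); last by rewrite lee_fin ge_min lexx orbT.
  apply: le_measure; rewrite ?inE//;
    try by apply: measurable_normr_ge; exact: measurable_funB.
  by move=> w /=; apply: le_trans; rewrite ge_min lexx.
exact: aeW.
Qed.

(** Markov's inequality under P, with the bound on K in L1(P), gives uniformly small
    P-probabilities, which domination of Q by P makes small under Q. *)
Lemma representatives_tight (e : R) : 0 < e -> exists2 M : R, 0 < M & forall f,
  representatives f -> (Q [set w | (M <= `|f w|)%R] < e%:E)%E.
Proof.
move=> e0; have [s s0 sP] := dominates_abs_continuous QP.1 e0.
(* For empty K the supremum is -oo, and 0 serves as the bound. *)
have [b bP] : exists b : R,
    (ereal_sup [set 'E_P[fun w => `|X w|%R] | X in K] <= b%:E)%E.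
  move: K_bounded; rewrite /L1_bounded; case: ereal_sup => [b||] // _.
    by exists b.
  by exists 0; rewrite leNye.
have M0 : 0 < (`|b| + 1) / s by rewrite divr_gt0// ltr_wpDl.
exists ((`|b| + 1) / s) => // f [mf [X KX fX]].
rewrite (@prob_ae_eq _ _ _ _ _ [set w | (`|b| + 1) / s <= `|X w|]); last first.
- by apply: filterS fX => w /= /(_ I) ->.
- exact: measurable_normr_ge.
- exact: measurable_normr_ge.
have nXi := integrable1_normr (L1_subset_integrable K_L1 KX).
apply: sP; first exact: measurable_normr_ge.
apply: le_trans (prob_ge_le nXi M0 _) _ => //.
have Xb : \int[P]_w `|X w| <= b.
  rewrite -lee_fin /Rintegral fineK; last exact: integrable_fin_num.
  apply: le_trans bP; apply: ereal_sup_ubound; exists X => //.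
  by rewrite unlock.
rewrite lee_fin ler_pdivrMr// mulrC divfK ?gt_eqF//.
by rewrite (le_trans Xb)// (le_trans (ler_norm b))// lerDl.
Qed.

Lemma topologies_agree_uniformly_integrable :
  L0_L1_topologies_agree KQ -> uniformly_integrable KQ.
Proof.
move=> /topologies_agreeP[KQ_L1 KQP].
have Fi f : representatives f -> Q.-integrable [set: T] (EFin \o f).
  move=> /representativesP[mf [X KX /eq_ae_sym fX]].
  exact: integrable1_ae_eq (L1_subset_integrable KQ_L1 KX).
(* Both the distance in probability and the distance in mean are unchanged under almost sure
   equality, so the condition passes from classes to all their versions. *)
have F_agree f (e : R) : representatives f -> 0 < e ->
    exists2 r : R, 0 < r & forall g, representatives g -> close_in_prob Q r f g ->
      \int[Q]_w `|f w - g w| < e.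
  move=> /representativesP[mf [X KX fX]] e0.
  have [r r0 rP] := KQP _ _ KX e0; exists r => // g.
  move=> /representativesP[mg [Y KY gY]] fg.
  rewrite (@Rintegral_ae_eq _ _ _ _ _ (fun w => `|X w - Y w|)).
  - by apply: rP => //; exact: close_in_prob_ae fg.
  - by apply: measurableT_comp => //; exact: measurable_funB.
  - by apply: measurableT_comp => //; exact: measurable_funB.
  - by apply: filterS2 fX gY => w /= fX gY wT; rewrite fX// gY.
have [B FB] := convex_tight_L1_bounded Fi representatives_convex
  representatives_tight F_agree.
apply: (uniformly_abs_continuous_integrable representatives_L0_change Fi FB).
apply: (convex_closed_uniformly_abs_continuous Fi FB) => //.
  move=> f g Ff Fg; have half : 0 <= (2^-1 : R) <= 1 by lra.
  rewrite (_ : (fun w => _) = fun w => 2^-1 * f w + (1 - 2^-1) * g w).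
    exact: representatives_convex.
  by apply/funext => w; field.
move=> y f; exact: representatives_closed.
Qed.

End change_of_probability.

Unset Implicit Arguments.

Theorem theorem1p3 (R : realType) (d : measure_display)
    (Omega : measurableType d) (P : probability Omega R) (K : set (L0 P)) :
  nonatomic P ->
  convex_set (K : set (convex_lmodType (L0 P))) ->
  L1_subset K -> L1_bounded K ->
  closed K ->
  (exists Q : probability Omega R,
     equivalent Q P /\ L0_L1_topologies_agree (L0_change Q @` K)) <->
  (exists Q : probability Omega R,
     equivalent Q P /\ uniformly_integrable (L0_change Q @` K)).
Proof.
move=> _ K_convex K_L1 K_bounded K_closed.
split=> -[Q [QP KQ]]; exists Q; split=> //.
  exact: topologies_agree_uniformly_integrable.
exact: uniformly_integrable_topologies_agree.
Qed.
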